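(* Let $D$ be a block design with parameters $(v,b,r,k,\lambda)$ built on a finite set $V$. Then $D$ is friends with itself, i.e. the partition $\varphi(D,B)$ does not depend on the choice of the block $B$ of $D$, in each of the following cases: (1) $\lambda=1$; (2) $k=3$; (3) $D$ is symmetric, i.e. $b=v$.
   Context: A block design with parameters $(v,b,r,k,\lambda)$ built on a finite set $V$ ($|V|=v$) is a list of $b$ blocks, each a $k$-subset of $V$, such that every element lies in exactly $r$ blocks and every pair of distinct elements lies in exactly $\lambda$ blocks; designs are simple (no repeated blocks). For a design $D$ with blocks $B_1,\dots,B_b$ and $M\subseteq V$, $\varphi(D,M)=(z_0,\dots,z_k)$ where $z_j$ is the number of $s$ with $|M\cap B_s|=j$. Two designs $D_1,D_2$ on $V$ are friends if $\varphi(D_1,D_2^i)$ is independent of the block $D_2^i$ of $D_2$ and $\varphi(D_2,D_1^j)$ is independent of the block $D_1^j$ of $D_1$; $D$ is friends with itself when this holds with $D_1=D_2=D$. *)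

(* Defs.v *)
From mathcomp Require Import all_boot.

Set Implicit Arguments.
Unset Strict Implicit.
Unset Printing Implicit Defensive.

Record block_design (V : finType) (v b r k lambda : nat) := BlockDesign {
  blocks :> b.-tuple {set V};
  design_card_points : #|V| = v;
  design_card_block : forall s : 'I_b, #|tnth blocks s| = k;
  design_replication :
    forall x : V, #|[set s : 'I_b | x \in tnth blocks s]| = r;
  design_balance :
    forall x y : V, x != y ->
      #|[set s : 'I_b | (x \in tnth blocks s) && (y \in tnth blocks s)]|
        = lambda;
  design_simple : uniq blocks
}.

Definition phi (V : finType) (v b r k lambda : nat)
    (D : block_design V v b r k lambda) (M : {set V}) : k.+1.-tuple nat :=
  [tuple #|[set s : 'I_b | #|M :&: tnth D s| == j]| | j < k.+1].

Definition friends (V : finType) (v1 b1 r1 k1 lambda1 : nat)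
    (v2 b2 r2 k2 lambda2 : nat)
    (D1 : block_design V v1 b1 r1 k1 lambda1)
    (D2 : block_design V v2 b2 r2 k2 lambda2) : Prop :=
  (forall i i' : 'I_b2, phi D1 (tnth D2 i) = phi D1 (tnth D2 i')) /\
  (forall j j' : 'I_b1, phi D2 (tnth D1 j) = phi D2 (tnth D1 j')).

Definition symmetric_design (V : finType) (v b r k lambda : nat)
    (D : block_design V v b r k lambda) : Prop := b = v.

(* Main.v *)
Require Import Defs.
From mathcomp Require Import all_boot.
From mathcomp Require Import zify.

(** For a block [B] of the design, the number of blocks, the sum of the
    intersection numbers [#|B :&: B_s|] and the sum of their squares depend only
    on the parameters.  When [lambda = 1], or when [k = 3] (as blocks are not
    repeated), the other blocks meet [B] in at most two points, so these three
    moments determine how often each intersection number occurs.  When [b = v],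
    the moments give [\sum_(s != i) (#|B_i :&: B_s| - lambda)^2 = 0], so all the
    other blocks meet [B] in exactly [lambda] points. *)

Set Implicit Arguments.
Unset Strict Implicit.
Unset Printing Implicit Defensive.

Lemma card_setI_sum (T : finType) (A B : {set T}) :
  #|A :&: B| = \sum_(x in A) (x \in B : nat).
Proof.
by rewrite -big_mkcondr -sum1_card; apply: eq_bigl => x; rewrite inE.
Qed.

Lemma card_set_sum (T : finType) (P : pred T) :
  #|[set s | P s]| = \sum_s (P s : nat).
Proof. by rewrite -big_mkcond -sum1_card; apply: eq_bigl => x; rewrite inE. Qed.

Section Moments.

Variables (V : finType) (v b r k lambda : nat).
Variable D : block_design V v b r k lambda.

Lemma sum_card_setI (M : {set V}) :
  \sum_(s < b) #|M :&: tnth D s| = #|M| * r.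
Proof.
under eq_bigr do rewrite card_setI_sum.
rewrite exchange_big /= -sum_nat_const; apply: eq_bigr => x _.
exact: etrans (esym (card_set_sum _)) (design_replication D x).
Qed.

(** Double counting of the triples [(x, y, s)] with [x] and [y] in [M] and in block [s]: for fixed
    [x], the choice [y = x] contributes [r] and each other [y] contributes [lambda]. *)
Lemma sum_card_setI_sqr (M : {set V}) :
  \sum_(s < b) #|M :&: tnth D s| ^ 2 = #|M| * (r + #|M|.-1 * lambda).
Proof.
under eq_bigr do rewrite card_setI_sum expnS expn1 big_distrlr.
rewrite exchange_big /= -sum_nat_const; apply: eq_bigr => x xM.
rewrite exchange_big /= (bigD1 x) //=; congr (_ + _).
  apply: etrans (design_replication D x); rewrite card_set_sum.
  by apply: eq_bigr => s _; case: (_ \in _).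
rewrite (cardD1 x) xM /= -sum_nat_const.
apply: eq_big => [y|y /andP[_ nyx]]; first by rewrite !inE andbC.
rewrite eq_sym in nyx.
apply: etrans (design_balance D nyx); rewrite card_set_sum.
by apply: eq_bigr => s _; rewrite mulnb.
Qed.

Lemma sum_block_inter (i : 'I_b) :
  k + \sum_(s | s != i) #|tnth D i :&: tnth D s| = k * r.
Proof.
have := sum_card_setI (tnth D i).
by rewrite (bigD1 i) //= setIid design_card_block.
Qed.

Lemma sum_block_inter_sqr (i : 'I_b) :
  k ^ 2 + \sum_(s | s != i) #|tnth D i :&: tnth D s| ^ 2
    = k * (r + k.-1 * lambda).
Proof.
have := sum_card_setI_sqr (tnth D i).
by rewrite (bigD1 i) //= setIid design_card_block.
Qed.

Lemma card_other_blocks (i : 'I_b) : \sum_(s < b | s != i) 1 = b.-1.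
Proof. by rewrite sum1_card cardC1 card_ord. Qed.

Lemma design_incidence : b * k = v * r.
Proof.
have := sum_card_setI setT; rewrite cardsT (design_card_points D) => <-.
under eq_bigr do rewrite setTI design_card_block.
by rewrite sum_nat_const card_ord.
Qed.

Lemma design_incidence_sqr : b * k ^ 2 = v * (r + v.-1 * lambda).
Proof.
have := sum_card_setI_sqr setT; rewrite cardsT (design_card_points D) => <-.
under eq_bigr do rewrite setTI design_card_block.
by rewrite sum_nat_const card_ord.
Qed.

Lemma phi_blockE (i : 'I_b) (j : 'I_k.+1) :
  tnth (phi D (tnth D i)) j
    = (k == j) + \sum_(s | s != i) (#|tnth D i :&: tnth D s| == j : nat).
Proof.
rewrite tnth_mktuple card_set_sum (bigD1 i) //=.
by rewrite setIid design_card_block.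
Qed.

(** A block meets itself in [k] points whichever block it is, so only the other blocks can make
    [phi] vary. With both designs equal, the two halves of [friends] coincide. *)
Lemma friends_self_of_count :
  (forall (i i' : 'I_b) (j : nat),
     \sum_(s | s != i) (#|tnth D i :&: tnth D s| == j : nat)
       = \sum_(s | s != i') (#|tnth D i' :&: tnth D s| == j : nat)) ->
  friends D D.
Proof.
move=> eqn; suff eqphi i i' : phi D (tnth D i) = phi D (tnth D i') by [].
by apply: eq_from_tnth => j; rewrite !phi_blockE (eqn i i').
Qed.

End Moments.

(** The moments of order 0, 1, 2 are linear in the numbers of occurrences of the values 0, 1, 2. The
    system is of Vandermonde type, hence invertible. *)
Lemma count_le2 (I : finType) (P : pred I) (f : I -> nat) :
  (forall s, P s -> f s <= 2) ->
  [/\ \sum_(s | P s) (f s == 0 : nat) + \sum_(s | P s) (f s == 1 : nat)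
        + \sum_(s | P s) (f s == 2 : nat) = \sum_(s | P s) 1,
      \sum_(s | P s) (f s == 1 : nat) + (\sum_(s | P s) (f s == 2 : nat)) * 2
        = \sum_(s | P s) f s,
      \sum_(s | P s) (f s == 1 : nat) + (\sum_(s | P s) (f s == 2 : nat)) * 4
        = \sum_(s | P s) f s ^ 2
    & forall j, 2 < j -> \sum_(s | P s) (f s == j : nat) = 0].
Proof.
move=> le2; rewrite !big_distrl -!big_split /=.
split; last by move=> j j2; apply: big1 => s /le2 fs; case: eqP => //; lia.
all: by apply: eq_bigr => s /le2; case: (f s) => [|[|[|]]].
Qed.

Lemma eq_count_le2 (I : finType) (P Q : pred I) (f g : I -> nat) :
  (forall s, P s -> f s <= 2) -> (forall s, Q s -> g s <= 2) ->
  \sum_(s | P s) 1 = \sum_(s | Q s) 1 ->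
  \sum_(s | P s) f s = \sum_(s | Q s) g s ->
  \sum_(s | P s) f s ^ 2 = \sum_(s | Q s) g s ^ 2 ->
  forall j, \sum_(s | P s) (f s == j : nat) = \sum_(s | Q s) (g s == j : nat).
Proof.
move=> /count_le2[f0 f1 f2 fj] /count_le2[g0 g1 g2 gj] e0 e1 e2.
by case=> [|[|[|j]]]; [lia | lia | lia | rewrite fj ?gj].
Qed.

Section SelfFriends.

Variables (V : finType) (v b r k lambda : nat).
Variable D : block_design V v b r k lambda.

Lemma friends_self_of_inter_le2 :
  (forall i s : 'I_b, s != i -> #|tnth D i :&: tnth D s| <= 2) -> friends D D.
Proof.
move=> le2; apply: friends_self_of_count => i i'.
apply: eq_count_le2; [exact: le2 | exact: le2 | | |].
- by rewrite !card_other_blocks.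
- by have := sum_block_inter D i; have := sum_block_inter D i'; lia.
- by have := sum_block_inter_sqr D i; have := sum_block_inter_sqr D i'; lia.
Qed.

(** Two distinct common points would lie together in both blocks [i] and [s], whereas only one block
    contains them. *)
Lemma inter_le1_of_lambda1 (i s : 'I_b) :
  lambda = 1 -> s != i -> #|tnth D i :&: tnth D s| <= 1.
Proof.
move=> l1 nsi; rewrite leqNgt; apply/negP => /card_gt1P[x [y []]].
rewrite !inE => /andP[xi xs] /andP[yi ys] nxy.
have /eqP := design_balance D nxy; rewrite [X in _ == X]l1 => /cards1P[t tE].
have /set1P si : s \in [set t] by rewrite -tE inE xs ys.
have /set1P ii : i \in [set t] by rewrite -tE inE xi yi.
by rewrite si ii eqxx in nsi.
Qed.

(** An intersection with at least [k] points would fill both blocks, making them a repeated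
    block. *)
Lemma inter_lt_block (i s : 'I_b) :
  s != i -> #|tnth D i :&: tnth D s| < k.
Proof.
apply: contraNltn => le_k.
have eqI (t : 'I_b) : tnth D i :&: tnth D s \subset tnth D t ->
    tnth D i :&: tnth D s = tnth D t.
  by move=> sub; apply/eqP; rewrite eqEcard sub (design_card_block D t).
have eq_is : tnth D s = tnth D i.
  by rewrite -(eqI s (subsetIr _ _)) (eqI i (subsetIl _ _)).
by apply/eqP; apply: (tuple_uniqP _ (design_simple D)) eq_is.
Qed.

Lemma symmetric_inter (i s : 'I_b) :
  symmetric_design D -> s != i -> #|tnth D i :&: tnth D s| = lambda.
Proof.
rewrite /symmetric_design => bv nsi.
have b0 : 0 < b by apply: leq_ltn_trans (ltn_ord i).
(* Cancelling [b = v], which is positive since [i] indexes a block, in the two counts with [M = V]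
   yields [rk] and [kE]. *)
have rk : k = r.
  have /eqP := design_incidence D.
  by rewrite -bv eqn_pmul2l // => /eqP.
have kE : k ^ 2 = r + b.-1 * lambda.
  have /eqP := design_incidence_sqr D.
  by rewrite -bv eqn_pmul2l // => /eqP.
pose a t := #|tnth D i :&: tnth D t|.
(* Subtraction-free form of the sum of squares [(a t - lambda)^2]: the sum of [2 * (a t * lambda)]
   is at most that of [a t ^ 2 + lambda ^ 2], with equality only if every [a t] with [t != i] is
   [lambda]. *)
have le_sum := leqif_sum (fun t (_ : t != i) => nat_Cauchy (a t) lambda).
have : \sum_(t | t != i) 2 * (a t * lambda)
         == \sum_(t | t != i) (a t ^ 2 + lambda ^ 2).
  apply/eqP; rewrite -big_distrr -big_distrl big_split /=.
  rewrite sum_nat_const cardC1 card_ord.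
  have := sum_block_inter D i; have := sum_block_inter_sqr D i.
  rewrite -/(a _); set S2 := bigop _ _ _; set S1 := bigop _ _ _.
  (* Both sides equal [2 * lambda * k * (k - 1)], because [kE] gives
     [(b - 1) * lambda = k * (k - 1)]. The case split on [k] removes the truncated [k.-1]. *)
  move: kE; rewrite -rk; case: (k) => [|k'] /= kE S2E S1E; nia.
by rewrite le_sum => /forall_inP/(_ s nsi)/eqP.
Qed.

Lemma friends_self_symmetric : symmetric_design D -> friends D D.
Proof.
move=> symD; apply: friends_self_of_count => i i' j.
transitivity (b.-1 * (lambda == j)).
  under eq_bigr => s nsi do rewrite symmetric_inter //.
  by rewrite sum_nat_const cardC1 card_ord.
under [RHS]eq_bigr => s nsi do rewrite symmetric_inter //.
by rewrite sum_nat_const cardC1 card_ord.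
Qed.

End SelfFriends.

Theorem theorem1 (V : finType) (v b r k lambda : nat)
    (D : block_design V v b r k lambda) :
  lambda = 1 \/ k = 3 \/ symmetric_design D -> friends D D.
Proof.
move=> [l1|[k3|symD]]; last exact: friends_self_symmetric.
- apply: friends_self_of_inter_le2 => i s nsi.
  exact/leqW/inter_le1_of_lambda1.
- apply: friends_self_of_inter_le2 => i s nsi.
  by rewrite -ltnS -k3; apply: inter_lt_block.
Qed.
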